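(* Let $n\in\{2,3,4,\dots\}$, and let $\lambda$ be such that the integrals below converge absolutely. Then $$S_n(\lambda,0,0)=\frac{1}{\bigl(n-1+2\lambda\phi(-in)\bigr)\bigl(n+2\lambda\phi(-in)\bigr)}\int_{0<t_2<\cdots<t_{n-1}<1}\prod_{1\le i<j\le n}|t_i-t_j|^{2\lambda d(j-i)}\Big|_{t_1=0,\ t_n=1}\,dt_2\cdots dt_{n-1}=\frac{S_{n-2}(\lambda,2\lambda,2\lambda)}{\bigl(n-1+2\lambda\phi(-in)\bigr)\bigl(n+2\lambda\phi(-in)\bigr)},$$ with the convention $S_0=1$.
   Context: Let $\sigma^2\ge0$ and let $\mathcal M$ be non-decreasing and continuous on $(-\infty,0)$ and $(0,\infty)$, with $\int_{[-1,1]\setminus\{0\}}u^2d\mathcal M(u)<\infty$, $\lim_{u\to\pm\infty}\mathcal M(u)=0$, decaying fast enough that the integrals below converge. For $m\in\mathbb N$ let $d(m)=\sigma^2+\int_{\mathbb R\setminus\{0\}}e^{(m-1)u}(e^u-1)^2\,d\mathcal M(u)$, and for $n\in\mathbb N$ let $$\phi(-in)=\frac{\sigma^2}{2}(n^2-n)+\int_{\mathbb R\setminus\{0\}}\bigl(e^{nu}-1-n(e^u-1)\bigr)\,d\mathcal M(u).$$ Define the generalized Selberg integral $$S_n(\lambda,\lambda_1,\lambda_2)=\int_{0<t_1<\cdots<t_n<1}\prod_{i=1}^n t_i^{\lambda_1 d(i)}(1-t_i)^{\lambda_2 d(n-i+1)}\prod_{1\le k<p\le n}|t_p-t_k|^{2\lambda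 d(p-k)}\,dt .$$ *)

(* Defs.v *)
From HB Require Import structures.
From mathcomp Require Import all_boot all_order all_algebra.
From mathcomp Require Import all_classical all_reals all_analysis.
Set Implicit Arguments. Unset Strict Implicit. Unset Printing Implicit Defensive.
Import Order.TTheory GRing.Theory Num.Theory.
Import numFieldNormedType.Exports.
Local Open Scope classical_set_scope.
Local Open Scope ring_scope.

Section Defs.
Variable R : realType.

Definition d_integrand (m : nat) (u : R) : R :=
  expR ((m.-1)%:R * u) * (expR u - 1) ^+ 2.

Definition dfun (sigma2 : R) (mu : {measure set R -> \bar R}) (m : nat) : R :=
  sigma2 + Rintegral mu [set~ 0] (d_integrand m).

Definition phi_integrand (n : nat) (u : R) : R :=
  expR (n%:R * u) - 1 - n%:R * (expR u - 1).

Definition phi_in (sigma2 : R) (mu : {measure set R -> \bar R}) (n : nat) : R :=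
  sigma2 / 2 * (n%:R ^+ 2 - n%:R) + Rintegral mu [set~ 0] (phi_integrand n).

Definition upd (t : nat -> R) (a : nat) (x : R) : nat -> R :=
  fun i => if i == a then x else t i.

Fixpoint iint (a k : nat) (F : (nat -> R) -> \bar R) (t : nat -> R)
  : \bar R :=
  match k with
  | 0 => F t
  | k'.+1 => (\int[lebesgue_measure]_(x in `]0%R, 1%R[) iint a.+1 k' F (upd t a x))%E
  end.

Definition ordered (t : nat -> R) (a b : nat) : bool :=
  all (fun i => t i < t i.+1) (iota a (b - a)).

Definition pairprod (d : nat -> R) (n : nat) (lam : R) (t : nat -> R) : R :=
  \prod_(1 <= k < n.+1) \prod_(k.+1 <= p < n.+1)
     powR `|t p - t k| (2 * lam * d (p - k)%N).

Definition singleprod (d : nat -> R) (n : nat) (lam1 lam2 : R) (t : nat -> R)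
  : R :=
  \prod_(1 <= i < n.+1)
     (powR (t i) (lam1 * d i) * powR (1 - t i) (lam2 * d (n - i + 1)%N)).

(* generalized Selberg integral S_n(lam,lam1,lam2) over 0<t_1<...<t_n<1;
   for n = 0 it is the empty product, i.e. 1 (the convention S_0 = 1) *)
Definition selberg (d : nat -> R) (n : nat) (lam lam1 lam2 : R) : \bar R :=
  iint 1 n (fun t => if ordered t 1 n
                     then (singleprod d n lam1 lam2 t * pairprod d n lam t)%:E
                     else 0%E) (fun _ => 0).

(* int_{0<t_2<...<t_(n-1)<1} prod_{1<=i<j<=n} |t_i-t_j|^{2 lam d(j-i)}
   evaluated at t_1 = 0, t_n = 1 *)
Definition middle_int (d : nat -> R) (n : nat) (lam : R) : \bar R :=
  iint 2 (n - 2) (fun t => if ordered t 2 (n.-1)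
                           then (pairprod d n lam t)%:E else 0%E)
       (fun i => if i == n then 1 else 0).

End Defs.

(* Main.v *)
(* Fix the smallest variable x = t_1 and the largest y = t_n and substitute
   t_i = x + (y - x) s_i in the others. The integrand is homogeneous of degree
   2 lam sum_(k<p) d(p-k) = 2 lam phi(-in), because phi(-i(n+1)) - phi(-in) is
   the telescoping sum d(1) + .. + d(n). The integral over the middle variables
   is therefore (y - x)^c times the one with t_1 = 0 and t_n = 1, where
   c = n - 2 + 2 lam phi(-in), and the integral of (y - x)^c over 0 < x < y < 1
   is P(c) P(c+1) with P(c) = int_0^1 s^c ds = 1/(c+1). *)

Require Import Defs.
From HB Require Import structures.
From mathcomp Require Import all_boot all_order all_algebra.
From mathcomp Require Import all_classical all_reals all_analysis.
From mathcomp Require Import measurable_realfun.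
From mathcomp Require Import ring lra zify.
Import Order.TTheory GRing.Theory Num.Theory.
Import numFieldNormedType.Exports.
Local Open Scope classical_set_scope.
Local Open Scope ring_scope.

(** * Affine changes of variable for nonnegative functions on the line *)

Section Affine.
Context {R : realType}.
Notation mu := (@lebesgue_measure R).

Lemma measurable_affine (x c : R) :
  measurable_fun [set: R] (fun v : R => x + c * v).
Proof.
apply: measurable_funD => //; exact: measurable_funM.
Qed.

(** Lebesgue measure is [c] times its image under [v |-> x + c * v], by uniqueness on half-open
    intervals. Nonnegativity gives the formula in [\bar R] without integrability. *)
Lemma ge0_integral_affine (x c : R) (g : R -> \bar R) : 0 < c ->
  measurable_fun [set: R] g -> (forall y, 0 <= g y)%E ->
  (\int[mu]_y g y = c%:E * \int[mu]_v g (x + c * v)%R)%E.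
Proof.
move=> c0 mg g0.
have c0' : 0 <= c by exact: ltW.
pose k : {nonneg R} := NngNum c0'.
pose h (v : measurableTypeR R) : measurableTypeR R := x + c * v.
have mh : measurable_fun [set: _] h := measurable_affine x c.
have E A : measurable A ->
    mu A = mscale k (pushforward mu h) A.
  move=> mA; apply: lebesgue_measure_unique => //= _ [[a b]] _ <-.
  rewrite /mscale/= /pushforward.
  have -> : h @^-1` `]a, b] =
            [set` `](a - x) / c, (b - x) / c]].
    apply/seteqP; split => v;
      rewrite /h/= !in_itv/= ltr_pdivrMr// ler_pdivlMr//;
      move=> /andP[h1 h2]; apply/andP; split; lra.
  rewrite !lebesgue_measure_itv/= !lte_fin ltr_pM2r ?invr_gt0// ltrD2r.
  case: ifPn => ab; last by rewrite mule0.
  by rewrite -!EFinD -EFinM; congr EFin; field; rewrite gt_eqF.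
rewrite (eq_measure_integral (mscale k (pushforward mu h))); last first.
  by move=> A mA _; exact: E.
rewrite ge0_integral_mscale//=; congr (_ * _)%E.
by rewrite ge0_integral_pushforward//= preimage_setT.
Qed.

Lemma ge0_integralN (g : R -> \bar R) :
  measurable_fun [set: R] g -> (forall y, 0 <= g y)%E ->
  (\int[mu]_y g y = \int[mu]_v g (- v)%R)%E.
Proof.
move=> mg g0.
rewrite (eq_measure_integral
  (pushforward mu (-%R : _ -> measurableTypeR R))); last first.
  by move=> A mA _; exact/esym/lebesgue_measureN.
by rewrite ge0_integral_pushforward//= ?preimage_setT.
Qed.

Lemma ge0_integral_onem (g : R -> \bar R) :
  measurable_fun [set: R] g -> (forall y, 0 <= g y)%E ->
  (\int[mu]_y g y = \int[mu]_v g (1 - v)%R)%E.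
Proof.
move=> mg g0; rewrite ge0_integralN//.
rewrite (@ge0_integral_affine (-1) 1 (fun v => g (- v)%R))//; last first.
  by apply: measurableT_comp => //; exact: measurable_oppr.
rewrite mul1e; apply: eq_integral => v _.
by congr g; ring.
Qed.

End Affine.

(** * Iterated integrals over a block of coordinates *)

Section IteratedIntegral.
Context {R : realType}.
Notation mu := (@lebesgue_measure R).
Implicit Types (F G : (nat -> R) -> \bar R) (t s : nat -> R) (a k : nat).
Local Open Scope ereal_scope.

(** Each variable runs over the whole line, so a substitution moves only the integrand; domains are
    encoded by integrands vanishing outside them. *)
Fixpoint itint a k F t : \bar R :=
  if k is k'.+1 then \int[mu]_x itint a.+1 k' F (upd t a x) else F t.

(* Quantifying over all parameter spaces makes this notion stable under
   integration in one coordinate, without a sigma-algebra on [nat -> R]. *)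
Definition measurable_functional F : Prop :=
  forall (d : measure_display) (T : measurableType d) (h : nat -> T -> R),
    (forall i, measurable_fun [set: T] (h i)) ->
    measurable_fun [set: T] (fun z => F (h ^~ z)).

Lemma measurable_upd (d : measure_display) (T : measurableType d)
    (h : nat -> T -> R) (f : T -> R) a :
  (forall i, measurable_fun [set: T] (h i)) -> measurable_fun [set: T] f ->
  forall i, measurable_fun [set: T] (fun z => upd (h ^~ z) a (f z) i).
Proof. by move=> mh mf i; rewrite /upd; case: eqP. Qed.

Lemma measurable_upd1 t a i : measurable_fun [set: R] (fun x => upd t a x i).
Proof. exact: (@measurable_upd _ _ (fun i _ => t i)). Qed.

Lemma measurable_functional1 F t a : measurable_functional F ->
  measurable_fun [set: R] (fun x => F (upd t a x)).
Proof. by move=> mF; apply: mF => i; exact: measurable_upd1. Qed.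

Lemma itint_ge0 a k F t : (forall s, 0 <= F s) -> 0 <= itint a k F t.
Proof.
move=> F0; elim: k a t => //= k IH a t.
by apply: integral_ge0 => x _; exact: IH.
Qed.

(** Tonelli on [T * R]: the integrated coordinate joins the parameter space, which is where the
    quantification over all [T] is used. *)
Lemma measurable_itint a k F : (forall s, 0 <= F s) ->
  measurable_functional F -> measurable_functional (itint a k F).
Proof.
move=> F0 mF; elim: k a => //= k IH a d T h mh.
apply: (@measurable_fun_fubini_tonelli_F _ _ T _ R mu
  (fun p => itint a.+1 k F (upd (h ^~ p.1) a p.2))).
- apply: (IH a.+1 _ _ (fun i p => upd (h ^~ p.1) a p.2 i)) => i.
  apply: (@measurable_upd _ _ (fun i p => h i p.1)) => [j|].
    exact: measurableT_comp.
  exact: measurable_snd.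
- by move=> p; exact: itint_ge0.
Qed.

(** Only points agreeing with the base points outside the integrated block are compared. The case
    [b = 1] renumbers variables; [b = 0] replaces the base point. *)
Lemma eq_itint_shift a b k F G t t' :
  (forall s s',
    (forall i, (i < a + b)%N || (a + b + k <= i)%N -> s i = t i) ->
    (forall i, (i < a)%N || (a + k <= i)%N -> s' i = t' i) ->
    (forall i, (a <= i < a + k)%N -> s (i + b)%N = s' i) ->
    F s = G s') ->
  itint (a + b) k F t = itint a k G t'.
Proof.
elim: k a t t' => [|k IH] a t t' FG /=; first by apply: FG => // i; lia.
apply: eq_integral => x _; apply: (IH a.+1) => s s' st st' ss'.
apply: FG => i ai.
- by rewrite st /upd ?ifF//; lia.
- by rewrite st' /upd ?ifF//; lia.
- have [->|ia] := eqVneq i a; last by apply: ss'; lia.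
  by rewrite st ?st' /upd ?eqxx//; lia.
Qed.

Lemma eq_itint a k F G t :
  (forall s, (forall i, (i < a)%N || (a + k <= i)%N -> s i = t i) ->
    F s = G s) ->
  itint a k F t = itint a k G t.
Proof.
move=> FG; have := @eq_itint_shift a 0 k F G t t; rewrite !addn0; apply.
move=> s s' st st' ss'; have -> : s = s'; last exact: FG.
apply/funext => i; have [ai|ai] := boolP (a <= i < a + k)%N.
  by rewrite -ss' ?addn0.
by rewrite st ?st'//; lia.
Qed.

Lemma itint_cst0 a k t : itint a k (fun=> 0) t = 0.
Proof.
elim: k a t => //= k IH a t.
by under eq_integral do rewrite IH; exact: integral0.
Qed.

Lemma itintZl a k F t (c : \bar R) : (forall s, 0 <= F s) ->
  measurable_functional F -> 0 <= c ->
  itint a k (fun s => c * F s) t = c * itint a k F t.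
Proof.
move=> F0 mF c0; elim: k a t => //= k IH a t.
under eq_integral do rewrite IH.
rewrite ge0_integralZl//; last by move=> x _; exact: itint_ge0.
by apply: measurable_functional1; exact: measurable_itint.
Qed.

(** Each of the [k] substitutions contributes a factor [c]. The base point has affine form too, so
    that updating a coordinate commutes with the map. *)
Lemma itint_affine a k F s (x c : R) : (forall s, 0 <= F s) ->
  measurable_functional F -> (0 < c)%R ->
  itint a k F (fun i => x + c * s i)%R =
  (c ^+ k)%:E * itint a k (fun s => F (fun i => x + c * s i)%R) s.
Proof.
move=> F0 mF c0; elim: k a s => [|k IH] a s /=; first by rewrite mul1e.
have upd_affine v : upd (fun i => x + c * s i)%R a (x + c * v)%R =
    (fun i => x + c * upd s a v i)%R.
  by apply/funext => i; rewrite /upd; case: eqP.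
rewrite (@ge0_integral_affine _ x c)//; last 2 first.
- by apply: measurable_functional1; exact: measurable_itint.
- by move=> y; exact: itint_ge0.
under eq_integral do rewrite upd_affine IH.
rewrite ge0_integralZl//; last 3 first.
- apply: measurable_functional1; apply: measurable_itint => // d T h mh.
  by apply: mF => i; exact: (measurableT_comp (measurable_affine x c) (mh i)).
- by move=> y _; exact: itint_ge0.
- by rewrite lee_fin exprn_ge0// ltW.
by rewrite muleA -EFinM -exprS.
Qed.

Lemma updC t a b (x y : R) : a != b ->
  upd (upd t a x) b y = upd (upd t b y) a x.
Proof.
move=> /eqP ab; apply/funext => i; rewrite /upd.
by case: eqP => [->|//]; case: eqP => // ba; case: ab.
Qed.

(** Tonelli moves the last coordinate outermost, whereas [itint] itself peels off the first;
    together they bring out [t_1] and [t_n]. *)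
Lemma itint_recr a k F t : (forall s, 0 <= F s) -> measurable_functional F ->
  itint a k.+1 F t = \int[mu]_y itint a k F (upd t (a + k) y).
Proof.
move=> F0 mF; elim: k a t => [|k IH] a t; first by rewrite addn0.
rewrite [LHS]/=.
transitivity (\int[mu]_x \int[mu]_y
    itint a.+1 k F (upd (upd t a x) (a.+1 + k) y)).
  by apply: eq_integral => x _; rewrite -IH.
rewrite (@fubini_tonelli _ _ _ _ _ mu mu
  (fun p => itint a.+1 k F (upd (upd t a p.1) (a.+1 + k) p.2))); last 2 first.
- apply: (measurable_itint _ _ _ F0 mF _ _
    (fun i p => upd (upd t a p.1) (a.+1 + k) p.2 i)) => i.
  apply: (@measurable_upd _ _ (fun i p => upd t a p.1 i)) => [j|].
    by apply: (@measurable_upd _ _ (fun i _ => t i) fst) => //;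
      exact: measurable_fst.
  exact: measurable_snd.
- by move=> p; exact: itint_ge0.
apply: eq_integral => y _ /=; apply: eq_integral => x _.
by rewrite updC ?addSnnS//; lia.
Qed.

Lemma iint_itint a k F t : iint a k F t =
  itint a k
    (fun s => if all (fun i => 0 < s i < 1)%R (iota a k) then F s else 0) t.
Proof.
elim: k a t => //= k IH a t; rewrite integral_mkcond; apply: eq_integral => x _.
rewrite patchE; case: ifPn => [|] xD.
  rewrite IH; apply: eq_itint => s sx.
  rewrite sx ?leqnn// /upd eqxx; move: xD; rewrite inE/= in_itv/= => ->.
  by [].
(* For [x] outside []0, 1[] the test already fails at coordinate [a]. *)
apply/esym; rewrite -[RHS](itint_cst0 a.+1 k (upd t a x)).
apply: eq_itint => s sx.
rewrite sx ?leqnn// /upd eqxx; move: xD; rewrite notin_setE/= in_itv/=.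
by move/negP/negbTE => ->.
Qed.

End IteratedIntegral.

(** * Integrals of a real power over the unit interval and over [0 < x < y < 1] *)

Section PowerIntegral.
Context {R : realType}.
Notation mu := (@lebesgue_measure R).
Local Open Scope ereal_scope.

Definition powR01_integral (c : R) : \bar R :=
  \int[mu]_(x in `]0%R, 1%R[) (x `^ c)%:E.

Definition powR01 (c x : R) : \bar R :=
  if (0 < x < 1)%R then (x `^ c)%:E else 0.

Lemma powR01_ge0 c x : 0 <= powR01 c x.
Proof. by rewrite /powR01; case: ifP => // _; rewrite lee_fin powR_ge0. Qed.

Lemma measurable_powRE c : measurable_fun [set: R] (fun x => (x `^ c)%:E).
Proof. by apply/measurable_EFinP; exact: measurable_powR. Qed.

Lemma measurable_powR01 c : measurable_fun [set: R] (powR01 c).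
Proof.
apply: measurable_fun_ifT => //; last exact: measurable_powRE.
by apply: measurable_and; apply: measurable_fun_ltr.
Qed.

Lemma powR01_integralE c : powR01_integral c = \int[mu]_x powR01 c x.
Proof.
rewrite /powR01_integral integral_mkcond; apply: eq_integral => x _.
by rewrite patchE/= mem_setE in_itv/=.
Qed.

Lemma integral_powR_left_half c :
  \int[mu]_(x in `]0%R, 2^-1%R[) (x `^ c)%:E =
  (2^-1 `^ (c + 1))%:E * powR01_integral c.
Proof.
have h0 : (0 < 2^-1 :> R)%R by rewrite invr_gt0.
pose g x : \bar R := if (0 < x < 2^-1)%R then (x `^ c)%:E else 0.
have mg : measurable_fun [set: R] g.
  apply: measurable_fun_ifT => //; last exact: measurable_powRE.
  by apply: measurable_and; apply: measurable_fun_ltr.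
have g0 y : 0 <= g y.
  by rewrite /g; case: ifP => // _; rewrite lee_fin powR_ge0.
transitivity (\int[mu]_x g x).
  rewrite integral_mkcond; apply: eq_integral => x _.
  by rewrite patchE/= mem_setE in_itv/=.
rewrite (@ge0_integral_affine _ 0%R 2^-1%R)//.
have E v : g (0 + 2^-1 * v)%R = (2^-1 `^ c)%:E * powR01 c v.
  rewrite /g /powR01 add0r pmulr_rgt0// gtr_pMr//.
  by case: ifP => [/andP[v0 _]|_]; rewrite ?mule0// powRM ?EFinM// ltW.
under eq_integral do rewrite E.
rewrite ge0_integralZl ?lee_fin ?powR_ge0//; last 2 first.
- exact: measurable_powR01.
- by move=> x _; exact: powR01_ge0.
rewrite powR01_integralE muleA -EFinM powRD ?(gt_eqF h0) ?implybT//.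
by rewrite powRr1 ?ltW// mulrC.
Qed.

Lemma powR01_integral_split c : powR01_integral c =
  (2^-1 `^ (c + 1))%:E * powR01_integral c +
  \int[mu]_(x in `[2^-1%R, 1%R]) (x `^ c)%:E.
Proof.
have h0 : (0 < 2^-1 :> R)%R by rewrite invr_gt0.
have h1 : (2^-1 <= 1 :> R)%R by rewrite invf_le1// ler1n.
(* The point [1] is null; without it the two pieces partition the open unit interval. *)
rewrite -integral_powR_left_half -integral_itv_bndo_bndc; last first.
  by apply: measurable_funTS; exact: measurable_powRE.
rewrite /powR01_integral -ge0_integral_setU//=; last 3 first.
- by apply: measurable_funTS; exact: measurable_powRE.
- by move=> x _; rewrite lee_fin powR_ge0.
- apply/disj_setPS => x [] /=; rewrite !in_itv/=. move=> /andP[_ a] /andP[b _].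
  by move: a; rewrite ltNge b.
by rewrite -itv_bndbnd_setU// bnd_simp ?ltW.
Qed.

(** This also covers [c = -1], which the closed form excludes. *)
Lemma integral_powR_right_half_gt0 c :
  0 < \int[mu]_(x in `[2^-1%R, 1%R]) (x `^ c)%:E.
Proof.
have h0 : (0 < 2^-1 :> R)%R by rewrite invr_gt0.
(* On [[1/2, 1]], [x ^ c >= x ^ |c| >= (1/2) ^ |c|] whatever the sign of [c]. *)
apply: (@lt_le_trans _ _ (\int[mu]_(x in `[2^-1%R, 1%R]) (2^-1 `^ `|c|)%:E)).
  rewrite integral_cst//= lebesgue_measure_itv/= lte_fin invf_lt1// ltr1n/=.
  rewrite -EFinD -EFinM lte_fin mulr_gt0 ?powR_gt0//.
  by rewrite subr_gt0 invf_lt1// ltr1n.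
apply: ge0_le_integral => //=.
  by apply: measurable_funTS; exact: measurable_powRE.
move=> x; rewrite in_itv/= => /andP[x1 x2]; rewrite lee_fin.
have x0 : (0 < x)%R by exact: lt_le_trans x1.
apply: (@le_trans _ _ (x `^ `|c|)%R).
  by apply: ge0_ler_powR => //; rewrite nnegrE ltW.
by apply: ger_powR; rewrite ?x0 ?ler_norm.
Qed.

(** The antiderivative [x^(c+1) / (c+1)] is smooth on [[1/2, 1]], away from the possible singularity
    at [0]. *)
Lemma integral_powR_right_half c : (c + 1 != 0)%R ->
  \int[mu]_(x in `[2^-1%R, 1%R]) (x `^ c)%:E =
  ((1 - 2^-1 `^ (c + 1)) / (c + 1))%:E.
Proof.
move=> c1.
have h0 : (0 < 2^-1 :> R)%R by rewrite invr_gt0.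
have dP (x : R) : (0 < x)%R -> derivable (@powR R ^~ (c + 1)%R) x 1%R.
  by move=> x0; apply: derivable_powR; rewrite in_itv/= x0.
have dF (x : R) : (0 < x)%R ->
    is_derive x 1%R (fun y => (c + 1)^-1 * y `^ (c + 1))%R (x `^ c)%R.
  move=> x0.
  have -> : (x `^ c = (c + 1)^-1 *: ((c + 1) * x `^ (c + 1 - 1)))%R.
    by rewrite addrK /GRing.scale/= mulrA mulVf// mul1r.
  apply: is_deriveZ; split; first exact: dP.
  by rewrite -powR_derive1 ?in_itv/= ?x0// derive1E.
have cF (x : R) : (0 < x)%R ->
    {for x, continuous (fun y => (c + 1)^-1 * y `^ (c + 1))%R}.
  move=> x0; apply/differentiable_continuous/derivable1_diffP.
  by case: (dF x x0).
rewrite (@continuous_FTC2 _ _ (fun y => (c + 1)^-1 * y `^ (c + 1))%R).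
- by rewrite -EFinD powR1; congr EFin; field.
- by rewrite invf_lt1// ltr1n.
- apply: continuous_in_subspaceT => x; rewrite inE/= in_itv/= => /andP[x1 _].
  have x0 : (0 < x)%R by exact: lt_le_trans x1.
  apply/differentiable_continuous/derivable1_diffP.
  by apply: derivable_powR; rewrite in_itv/= x0.
- split.
  + move=> x; rewrite in_itv/= => /andP[x1 _].
    by case: (dF x (lt_trans h0 x1)).
  + by apply: cvg_at_right_filter; exact: cF.
  + by apply: cvg_at_left_filter; exact: cF.
- move=> x; rewrite in_itv/= => /andP[x1 _].
  have x0 := lt_trans h0 x1.
  by rewrite derive1E; case: (dF x x0).
Qed.

Lemma powR01_integral_gt0 c : 0 < powR01_integral c.
Proof.
rewrite powR01_integral_split.
apply: (lt_le_trans (integral_powR_right_half_gt0 c)); rewrite leeDr//.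
rewrite mule_ge0 ?lee_fin ?powR_ge0//.
by apply: integral_ge0 => x _; rewrite lee_fin powR_ge0.
Qed.

(* Halving the interval gives [P = 2^-(c+1) P + int_[1/2,1] x^c], which
   determines [P] as soon as it is finite: no improper integral is needed. *)
Lemma powR01_integral_fin c : powR01_integral c < +oo ->
  (c + 1 != 0)%R /\ powR01_integral c = ((c + 1)^-1)%:E.
Proof.
move=> Poo.
have Pfin : powR01_integral c \is a fin_num.
  by rewrite ge0_fin_numE// ltW// powR01_integral_gt0.
have c1 : (c + 1 != 0)%R.
  (* For [c = -1] the scaling factor is [1], and the finite [P] would equal itself plus a positive
     number. *)
  apply/eqP => c1; have := powR01_integral_split c.
  rewrite c1 powRr0 mul1e -(fineK Pfin).
  have := integral_powR_right_half_gt0 c.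
  case: (\int[mu]_(x in _) _) => [q||]//; rewrite lte_fin => q0 [].
  by move/eqP; rewrite -subr_eq0 opprD addNKr oppr_eq0 gt_eqF.
split => //; have := powR01_integral_split c.
rewrite integral_powR_right_half// -(fineK Pfin) -EFinM -EFinD => -[E].
congr EFin.
have h1 : (1 - 2^-1 `^ (c + 1) != 0 :> R)%R.
  rewrite subr_eq0 eq_sym powR_eq1 (negbTE c1) orbF negb_or -leNgt invr_ge0.
  by rewrite ler0n andbT invr_eq1; apply/eqP; lra.
apply: (mulfI h1); rewrite mulrBl mul1r {1}E; ring.
Qed.

(** With [y = x + (1 - x) v] the inner integral becomes [(1 - x)^(c+1) P(c) m], and the reflection
    [x |-> 1 - x] then gives [P(c+1)]. The value [m] may be infinite. *)
Lemma integral_powR_simplex c (m : \bar R) : 0 <= m ->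
  \int[mu]_x \int[mu]_y
    (if [&& 0 < x, x < y & y < 1]%R then ((y - x) `^ c)%:E * m else 0) =
  powR01_integral c * powR01_integral (c + 1) * m.
Proof.
move=> m0.
pose K x y : \bar R :=
  if [&& 0 < x, x < y & y < 1]%R then ((y - x) `^ c)%:E * m else 0.
have K0 x y : 0 <= K x y.
  by rewrite /K; case: ifP => // _; rewrite mule_ge0// lee_fin powR_ge0.
have P0 c' : 0 <= powR01_integral c' by exact/ltW/powR01_integral_gt0.
have mK x : measurable_fun [set: R] (K x).
  apply: measurable_fun_ifT => //.
    by apply: measurable_and => //; apply: measurable_and;
      apply: measurable_fun_ltr.
  apply: emeasurable_funM => //; apply/measurable_EFinP.
  have mB : measurable_fun [set: R] (fun y => y - x)%R.
    exact: measurable_funB.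
  exact: (measurableT_comp (measurable_powR c) mB).
have inner x : \int[mu]_y K x y =
    powR01 (c + 1) (1 - x) * (powR01_integral c * m).
  rewrite /powR01; case: ifPn => [x01|x01]; last first.
    rewrite mul0e; apply: integral0_eq => y _; rewrite /K ifF//.
    by apply/negbTE; apply: contra x01 => /and3P[a b d]; apply/andP; split; lra.
  have x1 : (0 < 1 - x)%R by lra.
  rewrite (@ge0_integral_affine _ x (1 - x)%R)//.
  have E v : K x (x + (1 - x) * v)%R = ((1 - x) `^ c)%:E * (powR01 c v * m).
    rewrite /K /powR01.
    have -> : (x < x + (1 - x) * v = (0 < v))%R.
      by rewrite ltrDl pmulr_rgt0.
    have -> : (x + (1 - x) * v < 1 = (v < 1))%R.
      by rewrite addrC -ltrBrDr gtr_pMr.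
    have -> : (0 < x)%R by lra.
    rewrite /= addrC addKr; case: ifP => [/andP[v0 _]|_]; last first.
      by rewrite mul0e mule0.
    by rewrite powRM ?EFinM ?muleA// ltW.
  under eq_integral do rewrite E.
  rewrite ge0_integralZl//=; last 3 first.
  - by apply: emeasurable_funM => //; exact: measurable_powR01.
  - by move=> y _; rewrite mule_ge0// powR01_ge0.
  - by rewrite lee_fin powR_ge0.
  rewrite ge0_integralZr//; last 2 first.
  - exact: measurable_powR01.
  - by move=> y _; rewrite powR01_ge0.
  rewrite -powR01_integralE !muleA -EFinM; congr (_ * _ * _).
  by rewrite powRD ?(gt_eqF x1) ?implybT// powRr1 ?ltW// mulrC.
transitivity (\int[mu]_x (powR01 (c + 1) (1 - x) * (powR01_integral c * m))).
  by apply: eq_integral => x _; exact: inner.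
rewrite -(@ge0_integral_onem _
  (fun v => powR01 (c + 1) v * (powR01_integral c * m))); last 2 first.
- by apply: emeasurable_funM => //; exact: measurable_powR01.
- by move=> y; rewrite !mule_ge0// powR01_ge0.
rewrite ge0_integralZr//; last 3 first.
- exact: measurable_powR01.
- by move=> y _; rewrite powR01_ge0.
- exact: mule_ge0.
by rewrite -powR01_integralE muleA; congr (_ * _); exact: muleC.
Qed.

End PowerIntegral.

(** * The Levy exponent as a sum of [dfun] over pairs *)

Section LevyExponent.
Context {R : realType} (sigma2 : R) (mu : {measure set R -> \bar R}).
Hypothesis d_fin : forall m : nat, (0 < m)%N ->
  (\int[mu]_(u in [set~ 0%R]) (d_integrand m u)%:E < +oo)%E.

Let measurable_set0C : measurable [set~ 0 : R].
Proof. exact: measurableC. Qed.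

Lemma measurable_d_integrand m : measurable_fun [set: R] (@d_integrand R m).
Proof.
apply: measurable_funM.
  by apply: (measurableT_comp (@measurable_expR R)); exact: measurable_funM.
by apply: measurable_funX; apply: measurable_funB => //; exact: measurable_expR.
Qed.

Lemma integrable_d_integrand m : (0 < m)%N ->
  mu.-integrable [set~ 0] (EFin \o d_integrand m).
Proof.
move=> m0; apply/integrableP; split.
  by apply/measurable_EFinP/measurable_funTS; exact: measurable_d_integrand.
rewrite (eq_integral (fun u => (d_integrand m u)%:E)) => [|u _ /=].
  exact: d_fin.
rewrite ger0_norm//.
by rewrite mulr_ge0 ?expR_ge0// sqr_ge0.
Qed.

(** One factor [e^u - 1] turns [e^((m-1)u)] into the difference [e^(mu) - e^((m-1)u)]; the other is
    common to all terms. *)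
Lemma d_integrand_telescope n (u : R) :
  \sum_(1 <= m < n.+1) d_integrand m u =
  (expR (n%:R * u) - 1) * (expR u - 1).
Proof.
elim: n => [|n IH]; first by rewrite big_nil mul0r expR0 subrr mul0r.
rewrite big_nat_recr//= IH /d_integrand/= -natr1.
rewrite [(_ + 1) * u]mulrDl mul1r expRD; ring.
Qed.

Lemma phi_integrand_recr n (u : R) :
  phi_integrand n.+1 u =
  phi_integrand n u + \sum_(1 <= m < n.+1) d_integrand m u.
Proof.
rewrite d_integrand_telescope /phi_integrand -natr1.
rewrite [(_ + 1) * u]mulrDl mul1r expRD; ring.
Qed.

Lemma integrable_sum_d_integrand n :
  mu.-integrable [set~ 0] (fun u => (\sum_(1 <= m < n.+1) d_integrand m u)%:E).
Proof.
elim: n => [|n IH].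
  by under eq_fun do rewrite big_nil; exact: integrable0.
under eq_fun do rewrite big_nat_recr//= EFinD.
by apply: integrableD => //; exact: integrable_d_integrand.
Qed.

Lemma Rintegral_sum_d_integrand n :
  Rintegral mu [set~ 0] (fun u => \sum_(1 <= m < n.+1) d_integrand m u) =
  \sum_(1 <= m < n.+1) Rintegral mu [set~ 0] (d_integrand m).
Proof.
elim: n => [|n IH].
  rewrite big_nil; under eq_fun do rewrite big_nil.
  by rewrite Rintegral_cst//= mul0r.
rewrite [RHS]big_nat_recr//= -IH -RintegralD//.
- by apply: eq_Rintegral => u _; rewrite big_nat_recr.
- exact: integrable_sum_d_integrand.
- exact: integrable_d_integrand.
Qed.

(** Induction from the zero integrand at [n = 0]: each increment is a finite sum of integrable
    functions. *)
Lemma integrable_phi_integrand n :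
  mu.-integrable [set~ 0] (EFin \o phi_integrand n).
Proof.
elim: n => [|n IH].
  rewrite (_ : EFin \o _ = cst 0%E); first exact: integrable0.
  by apply/funext => u /=; rewrite /phi_integrand !mul0r expR0 subrr subr0.
have -> : EFin \o phi_integrand n.+1 = ((EFin \o phi_integrand n) \+
    (fun u : R => (\sum_(1 <= m < n.+1) d_integrand m u)%:E))%E.
  by apply/funext => u /=; rewrite phi_integrand_recr EFinD.
by apply: integrableD => //; exact: integrable_sum_d_integrand.
Qed.

(** The jump part integrates the pointwise recurrence; the Gaussian part grows by [sigma2 / 2 * 2n],
    that is one [sigma2] for each [dfun]. *)
Lemma phi_in_recr n : phi_in sigma2 mu n.+1 =
  phi_in sigma2 mu n + \sum_(1 <= m < n.+1) dfun sigma2 mu m.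
Proof.
have -> : \sum_(1 <= m < n.+1) dfun sigma2 mu m =
    n%:R * sigma2 + \sum_(1 <= m < n.+1) Rintegral mu [set~ 0] (d_integrand m).
  rewrite /dfun big_split/=; congr (_ + _).
  by rewrite big_const_nat subn1 iter_addr_0 mulr_natl.
rewrite -Rintegral_sum_d_integrand /phi_in.
have -> : Rintegral mu [set~ 0] (phi_integrand n.+1) =
    Rintegral mu [set~ 0] (phi_integrand n) +
    Rintegral mu [set~ 0] (fun u => \sum_(1 <= m < n.+1) d_integrand m u).
  rewrite -RintegralD//.
  - by apply: eq_Rintegral => u _; exact: phi_integrand_recr.
  - exact: integrable_phi_integrand.
  - exact: integrable_sum_d_integrand.
by rewrite -natr1; field.
Qed.

Lemma phi_in0 : phi_in sigma2 mu 0 = 0.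
Proof.
rewrite /phi_in expr0n/= subrr mulr0 add0r.
rewrite (_ : phi_integrand 0 = cst 0); first by rewrite Rintegral_cst//= mul0r.
by apply/funext => u; rewrite /phi_integrand !mul0r expR0 subrr subr0.
Qed.

(** Passing from [n] to [n + 1] adds the pairs [(k, n + 1)], whose gaps run through [n, ..., 1]:
    exactly the increment of [phi_in]. *)
Lemma sum_pairs_dfun n :
  \sum_(1 <= k < n.+1) \sum_(k.+1 <= p < n.+1) dfun sigma2 mu (p - k) =
  phi_in sigma2 mu n.
Proof.
elim: n => [|n IH]; first by rewrite big_nil phi_in0.
rewrite phi_in_recr -IH big_nat_recr//= [X in _ + X]big_geq// addr0.
rewrite [X in _ = _ + X]big_nat_rev/= -big_split/= big_nat [RHS]big_nat.
by apply: eq_bigr => k /andP[k1 kn]; rewrite big_nat_recr.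
Qed.

End LevyExponent.

(** * The integrand on ordered points and its behaviour under affine maps *)

Section SelbergIntegrand.
Context {R : realType}.
Implicit Types (d t s : nat -> R) (n : nat) (lam : R).

Lemma orderedP t a b :
  reflect (forall i j, (a <= i)%N -> (i < j)%N -> (j <= b)%N -> t i < t j)
          (ordered t a b).
Proof.
apply: (iffP allP) => [ot i j ai ij jb|ot i]; last first.
  by rewrite mem_iota => ib; apply: ot; lia.
elim: j ij jb => // j IH ij jb.
have tj : t j < t j.+1 by apply: ot; rewrite mem_iota; lia.
have [->//|ij'] := eqVneq i j.
by apply: lt_trans tj; apply: IH; lia.
Qed.

Lemma eq_ordered t s n : (forall i, (1 <= i <= n)%N -> t i = s i) ->
  ordered t 1 n = ordered s 1 n.
Proof.
move=> ts; apply: eq_in_all => i; rewrite mem_iota => ib.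
by rewrite !ts//; lia.
Qed.

Lemma eq_pairprod d n lam t s : (forall i, (1 <= i <= n)%N -> t i = s i) ->
  pairprod d n lam t = pairprod d n lam s.
Proof.
move=> ts; apply: eq_big_nat => k kn; apply: eq_big_nat => p pn.
by rewrite !ts//; lia.
Qed.

Lemma pairprod_ge0 d n lam t : 0 <= pairprod d n lam t.
Proof. by do 2 (apply: prodr_ge0 => ? _); exact: powR_ge0. Qed.

Lemma ordered_affine t n (x c : R) : 0 < c ->
  ordered (fun i => x + c * t i) 1 n = ordered t 1 n.
Proof. by move=> c0; apply: eq_all => i; rewrite ltrD2l ltr_pM2l. Qed.

Lemma prod_powR (x : R) (e : nat -> R) (m n : nat) : 0 < x ->
  \prod_(m <= i < n) x `^ e i = x `^ (\sum_(m <= i < n) e i).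
Proof.
move=> x0; apply/esym/big_morph => [a b|]; last exact: powRr0.
by rewrite powRD// (gt_eqF x0) implybT.
Qed.

(** Translations cancel in the differences, and each pair contributes
    [c ^ (2 * lam * d (p - k))]. *)
Lemma pairprod_affine d n lam t (x c : R) : 0 < c ->
  pairprod d n lam (fun i => x + c * t i) =
  c `^ (2 * lam * \sum_(1 <= k < n.+1) \sum_(k.+1 <= p < n.+1) d (p - k)%N) *
  pairprod d n lam t.
Proof.
move=> c0; rewrite mulr_sumr -prod_powR// -big_split/=.
apply: eq_bigr => k _; rewrite mulr_sumr -prod_powR// -big_split/=.
apply: eq_bigr => p _.
by rewrite opprD addrACA subrr add0r -mulrBr normrM (gtr0_norm c0) powRM// ltW.
Qed.

Lemma singleprod00 d n t : singleprod d n 0 0 t = 1.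
Proof. by apply: big1 => i _; rewrite !mul0r !powRr0 mulr1. Qed.

(** The bounds [0 < t_1] and [t_n < 1] are left out, so that an increasing affine map only
    multiplies the function by a power. *)
Definition simplex_integrand d n lam t : \bar R :=
  if ordered t 1 n then (pairprod d n lam t)%:E else 0%E.

Lemma simplex_integrand_ge0 d n lam t : (0 <= simplex_integrand d n lam t)%E.
Proof.
by rewrite /simplex_integrand; case: ifP => // _; rewrite lee_fin pairprod_ge0.
Qed.

Lemma eq_simplex_integrand d n lam t s :
  (forall i, (1 <= i <= n)%N -> t i = s i) ->
  simplex_integrand d n lam t = simplex_integrand d n lam s.
Proof.
move=> ts; rewrite /simplex_integrand.
by rewrite (eq_ordered _ _ _ ts) (eq_pairprod _ _ _ _ _ ts).
Qed.

Lemma simplex_integrand_affine d n lam t (x c : R) : 0 < c ->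
  simplex_integrand d n lam (fun i => x + c * t i) =
  ((c `^ (2 * lam * \sum_(1 <= k < n.+1)
      \sum_(k.+1 <= p < n.+1) d (p - k)%N))%:E * simplex_integrand d n lam t)%E.
Proof.
move=> c0; rewrite /simplex_integrand ordered_affine// pairprod_affine//.
by case: ifP => _; rewrite ?mule0// EFinM.
Qed.

Lemma measurable_fun_prod (disp : measure_display) (T : measurableType disp)
    (f : nat -> T -> R) (r : seq nat) :
  (forall i, measurable_fun [set: T] (f i)) ->
  measurable_fun [set: T] (fun z => \prod_(i <- r) f i z).
Proof.
move=> mf; elim: r => [|i r IH].
  by under eq_fun do rewrite big_nil; exact: measurable_cst.
by under eq_fun do rewrite big_cons; exact: measurable_funM.
Qed.

Lemma measurable_simplex_integrand d n lam :
  measurable_functional (simplex_integrand d n lam).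
Proof.
move=> disp T h mh; apply: measurable_fun_ifT => //.
  rewrite /ordered; elim: (iota _ _) => //= i r IH.
  by apply: measurable_and => //; exact: measurable_fun_ltr.
apply/measurable_EFinP; apply: measurable_fun_prod => k.
apply: measurable_fun_prod => p.
have mB : measurable_fun [set: T] (fun z => `|h p z - h k z|).
  by apply: measurableT_comp => //; exact: measurable_realfun.measurable_funB.
exact: (measurableT_comp (@measurable_powR R _) mB).
Qed.

(* The factors with [k = 1] or [p = n] become powers of [t_i] and [1 - t_i]. *)
Lemma pairprod_endpoints d m lam t s : t 1%N = 0 -> t m.+2 = 1 ->
  (forall i, (1 <= i <= m)%N -> 0 < s i < 1) ->
  (forall i, (1 <= i <= m)%N -> t i.+1 = s i) ->
  pairprod d m.+2 lam t =
  singleprod d m (2 * lam) (2 * lam) s * pairprod d m lam s.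
Proof.
move=> t1 tn s01 ts.
(* With [n = m + 2], row [k = 1] is split off, row [k = n] is empty, and the factor of the pair
   [(1, n)] is [1]. *)
rewrite /pairprod big_ltn// [X in _ * X]big_nat_recr//=.
rewrite [X in _ * (_ * X)]big_geq// mulr1.
rewrite [X in X * _]big_nat_recr//= t1 tn subr0 normr1 powR1 mulr1.
rewrite /singleprod !big_add1/= big_split/= -mulrA; congr (_ * _).
  rewrite big_nat [RHS]big_nat; apply: eq_bigr => i im.
  have ? := s01 i.+1 im.
  by rewrite ts// subr0 gtr0_norm ?subn1//; lra.
rewrite -big_split/= big_nat [RHS]big_nat; apply: eq_bigr => i im.
have ? := s01 i.+1 im.
rewrite big_nat_recr/=; last by lia.
rewrite tn ts// gtr0_norm; last by lra.
rewrite mulrC; congr (_ * _); first by congr (_ `^ (_ * d _)); lia.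
rewrite big_add1/= big_nat [RHS]big_nat; apply: eq_bigr => p pm.
by rewrite !ts//; lia.
Qed.

End SelbergIntegrand.

(** * Integrating out the middle variables, then the two extreme ones *)

Section Selberg.
Context {R : realType} (d : nat -> R) (m : nat) (lam : R).
Notation mu := (@lebesgue_measure R).
Notation G := (simplex_integrand d m.+2 lam).
Notation endpoints := (fun i : nat => if i == m.+2 then 1 : R else 0).
Notation degree := (2 * lam *
  \sum_(1 <= k < m.+3) \sum_(k.+1 <= p < m.+3) d (p - k)%N).

(** With [t_1 = 0] and [t_n = 1], ordering all [n] points amounts to ordering the middle ones inside
    []0, 1[]. *)
Lemma middle_int_itint :
  middle_int d m.+2 lam = itint 2 m G endpoints.
Proof.
rewrite /middle_int iint_itint subn2/=; apply: eq_itint => s st.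
have s1 : s 1%N = 0 by rewrite st.
have sn : s m.+2 = 1 by rewrite st ?eqxx//; lia.
rewrite /simplex_integrand.
case: (orderedP s 1 m.+2) => [os|nos].
  rewrite ifT; last first.
    apply/allP => i; rewrite mem_iota => im.
    by rewrite -s1 -sn !os//; lia.
  by rewrite ifT//; apply/orderedP => i j *; apply: os; lia.
(* For a pair [i < j] the bounds of the unit interval matter only when [i = 1] or [j = n]. *)
case: ifP => // /allP s01; case: ifP => // /orderedP os; case: nos => i j.
rewrite leq_eqVlt => /orP[/eqP <-|i1] ij; rewrite leq_eqVlt => /orP[/eqP jE|jm].
- by rewrite jE s1 sn ltr01.
- by rewrite s1; have /s01/andP[] // : j \in iota 2 m by rewrite mem_iota; lia.
- rewrite jE sn.
  by have /s01/andP[] // : i \in iota 2 m by rewrite mem_iota; lia.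
- by apply: os; lia.
Qed.

Lemma middle_int_ge0 : (0 <= middle_int d m.+2 lam)%E.
Proof.
rewrite middle_int_itint.
by apply: itint_ge0 => s; exact: simplex_integrand_ge0.
Qed.

(** With [t_(i+1) = s_i], the distances to the fixed endpoints [0] and [1] supply the single
    factors, each with parameter [2 * lam]. *)
Lemma middle_int_selberg :
  middle_int d m.+2 lam = selberg d m lam (2 * lam) (2 * lam).
Proof.
rewrite /middle_int /selberg !iint_itint subn2/=.
apply: (@eq_itint_shift _ 1 1) => s s' st st' ss'.
have E : all (fun i => 0 < s i < 1) (iota 2 m) =
         all (fun i => 0 < s' i < 1) (iota 1 m).
  rewrite (iotaDl 1 1) all_map; apply: eq_in_all => i.
  by rewrite mem_iota => im /=; rewrite -(ss' i) ?addn1 ?add1n//; lia.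
rewrite E; case: ifP => // /allP s01.
have -> : ordered s 2 m.+1 = ordered s' 1 m.
  apply/orderedP/orderedP => os i j *.
    by rewrite -!ss' ?os//; lia.
  have := os i.-1 j.-1; rewrite -!ss'; try lia.
  by rewrite !addn1 !prednK; try lia; apply; lia.
case: ifP => // _; congr EFin; apply: pairprod_endpoints.
- by rewrite st.
- by rewrite st ?eqxx//; lia.
- by move=> i im; apply: s01; rewrite mem_iota; lia.
- by move=> i im; rewrite -ss' ?addn1//; lia.
Qed.

(** The affine map of [[0, 1]] onto [[t_1, t_n]] yields the exponent [m] from its Jacobian and
    [degree] from the homogeneity of [G]. *)
Lemma itint_simplex_affine t : t 1%N < t m.+2 ->
  itint 2 m G t =
  (((t m.+2 - t 1%N) `^ (m%:R + degree))%:E * middle_int d m.+2 lam)%E.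
Proof.
move=> t1n; set c := t m.+2 - t 1%N.
have c0 : 0 < c by rewrite subr_gt0.
(* [G] reads only the indices [1] to [n]; of these just [1] and [n] lie outside the block, and there
   the two base points agree. *)
transitivity (itint 2 m G (fun i => t 1%N + c * endpoints i)).
  apply: (@eq_itint_shift _ 2 0) => s s' st st' ss'.
  apply: eq_simplex_integrand => i im.
  have [i2|i2] := boolP (2 <= i < 2 + m)%N; first by rewrite -ss' ?addn0.
  rewrite st ?st'; try lia.
  have [->|im2] := eqVneq i m.+2; first by rewrite /c; ring.
  by have -> : i = 1%N; [lia|rewrite mulr0 addr0].
rewrite itint_affine//; last 2 first.
- by move=> s; exact: simplex_integrand_ge0.
- exact: measurable_simplex_integrand.
under eq_itint do rewrite simplex_integrand_affine//.
rewrite itintZl ?lee_fin ?powR_ge0//; last 2 first.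
- by move=> s; exact: simplex_integrand_ge0.
- exact: measurable_simplex_integrand.
rewrite middle_int_itint muleA -EFinM powRD ?(gt_eqF c0) ?implybT//.
by rewrite powR_mulrn ?ltW.
Qed.

(** Integrating [t_1] and [t_n] last leaves a power of [t_n - t_1] on [0 < t_1 < t_n < 1]. *)
Lemma selberg00 : selberg d m.+2 lam 0 0 =
  (powR01_integral (m%:R + degree) * powR01_integral (m%:R + degree + 1) *
   middle_int d m.+2 lam)%E.
Proof.
(* For ordered points the bounds of []0, 1[] need checking only at the first and the last. *)
pose H (t : nat -> R) : \bar R :=
  if (0 < t 1%N) && (t m.+2 < 1) then G t else 0%E.
have H0 t : (0 <= H t)%E.
  by rewrite /H; case: ifP => // _; exact: simplex_integrand_ge0.
have mH : measurable_functional H.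
  move=> disp T h mh; apply: measurable_fun_ifT => //.
    by apply: measurable_and; apply: measurable_fun_ltr.
  exact: measurable_simplex_integrand.
rewrite /selberg iint_itint.
transitivity (itint 1 m.+2 H (fun=> 0)).
  apply: eq_itint => s _; rewrite /H /simplex_integrand singleprod00 mul1r.
  case: (orderedP s 1 m.+2) => [os|]; last by rewrite !if_same.
  congr (if _ then _ else _); apply/allP/andP => [s01|[s0 s1] i].
    split.
      by have /s01/andP[] // : 1%N \in iota 1 m.+2 by rewrite mem_iota.
    by have /s01/andP[] // : m.+2 \in iota 1 m.+2 by rewrite mem_iota; lia.
  rewrite mem_iota => im; apply/andP; split.
    have [->//|i1] := eqVneq i 1%N.
    by apply: lt_trans s0 _; apply: os; lia.
  have [->//|i1] := eqVneq i m.+2.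
  by apply: lt_trans s1; apply: os; lia.
rewrite -integral_powR_simplex ?middle_int_ge0// [LHS]/=.
apply: eq_integral => x _; rewrite -[LHS]/(itint 2 m.+1 H (upd (fun=> 0) 1 x)).
rewrite itint_recr//; apply: eq_integral => y _.
set t := upd _ _ y.
have t1 : t 1%N = x by rewrite /t add2n.
have tn : t m.+2 = y by rewrite /t add2n /upd eqxx.
case: ifPn => [/and3P[x0 xy y1]|xy].
  rewrite -t1 -tn -itint_simplex_affine ?t1 ?tn//.
  apply: eq_itint => s st; rewrite /H !st ?t1 ?tn ?x0 ?y1//; lia.
(* A nonzero value of [H] would force [0 < x < y < 1]. *)
rewrite -[RHS](itint_cst0 2 m t); apply: eq_itint => s st.
rewrite /H /simplex_integrand; case: ifP => // /andP[s0 s1].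
case: orderedP => // os; case/negP: xy.
rewrite -t1 -tn -!st; try lia.
by rewrite s0 s1 os.
Qed.

End Selberg.

Theorem theorem3 (R : realType) (sigma2 : R) (M : R -> R)
  (mu : {measure set R -> \bar R}) (n : nat) (lam : R) :
  0 <= sigma2 ->
  (* M non-decreasing and continuous on (-oo,0) and on (0,+oo) *)
  {in `]-oo, 0[ &, {homo M : x y / x <= y}} ->
  {in `]0, +oo[ &, {homo M : x y / x <= y}} ->
  {within `]-oo, 0[, continuous M} ->
  {within `]0, +oo[, continuous M} ->
  M x @[x --> -oo] --> 0 ->
  M x @[x --> +oo] --> 0 ->
  (* mu is the measure dM on R \ {0} *)
  (forall u : R, u < 0 -> mu [set` `]-oo, u]%R] = (M u)%:E) ->
  (forall u : R, 0 < u -> mu [set` `]u, +oo[%R] = (- M u)%:E) ->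
  (\int[mu]_(u in [set` `[-1, 1]%R] `\ 0%R) (u ^+ 2)%:E < +oo)%E ->
  (* the integrals defining d(m) and phi(-im) converge *)
  (forall m : nat, (0 < m)%N ->
     (\int[mu]_(u in [set~ 0%R]) (d_integrand m u)%:E < +oo)%E) ->
  (forall m : nat, (0 < m)%N ->
     (\int[mu]_(u in [set~ 0%R]) (phi_integrand m u)%:E < +oo)%E) ->
  (2 <= n)%N ->
  (* the integrals converge (absolutely: the integrands are nonnegative) *)
  (selberg (dfun sigma2 mu) n lam 0 0 < +oo)%E ->
  (middle_int (dfun sigma2 mu) n lam < +oo)%E ->
  (selberg (dfun sigma2 mu) (n - 2) lam (2 * lam) (2 * lam) < +oo)%E ->
  let den := ((n.-1)%:R + 2 * lam * phi_in sigma2 mu n) *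
             (n%:R + 2 * lam * phi_in sigma2 mu n) in
  selberg (dfun sigma2 mu) n lam 0 0
    = (middle_int (dfun sigma2 mu) n lam * (den^-1)%:E)%E /\
  (middle_int (dfun sigma2 mu) n lam * (den^-1)%:E)%E
    = (selberg (dfun sigma2 mu) (n - 2) lam (2 * lam) (2 * lam) * (den^-1)%:E)%E.
Proof.
move=> _ _ _ _ _ _ _ _ _ _ d_fin _; case: n => [//|[//|m]] _ Soo _ _ den.
split; last by rewrite middle_int_selberg subn2.
move: Soo; rewrite selberg00 (sum_pairs_dfun sigma2 mu d_fin m.+2).
set a := 2 * lam * _; set M0 := middle_int _ _ _ => Soo.
have M0_ge0 : (0 <= M0)%E by exact: middle_int_ge0.
(* For M0 != 0, finiteness of S_n = P Q M0 forces P and Q to be finite, so no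
   sign condition on the two factors of [den] has to be assumed. *)
have [->|M0_neq0] := eqVneq M0 0%E; first by rewrite mule0 mul0e.
have M0_gt0 : (0 < M0)%E by rewrite lt0e M0_neq0.
set P := powR01_integral (m%:R + a); set Q := powR01_integral (m%:R + a + 1).
have P0 : (0 < P)%E by exact: powR01_integral_gt0.
have Q0 : (0 < Q)%E by exact: powR01_integral_gt0.
have Poo : (P < +oo)%E.
  rewrite ltey; apply: contraTneq Soo => Py.
  by rewrite -/P Py gt0_mulye// gt0_mulye// ltxx.
have Qoo : (Q < +oo)%E.
  rewrite ltey; apply: contraTneq Soo => Qy.
  by rewrite -/Q Qy gt0_muley// gt0_mulye// ltxx.
have [_ PE] := powR01_integral_fin _ Poo.
have [_ QE] := powR01_integral_fin _ Qoo.
rewrite /P /Q PE QE muleC -EFinM; congr (_ * _%:E)%E.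
(* Here [n = m + 2] and [c = m + a], so [c + 1 = n - 1 + a] and [c + 2 = n + a]. *)
rewrite /den -invfM -/a; congr (_ * _)^-1; rewrite -?natr1 /=; ring.
Qed.
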